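(* Let $K\in\mathbb{R}^{N\times N}$, $N=n^2$, let $1\le k<N$, let $K_{\mathrm{TSVD}}=U_k\Sigma_kV_k^T$ be the true truncated SVD operator of $K$, and let $\widehat K_{\mathrm{TSVD}}=\widehat U_k\widehat\Sigma_k\widehat V_k^T$ be its approximation constructed from the Kronecker sum decomposition of $K$ as described in the context, where $\sigma_k>0$ and $\widehat\sigma_k>0$. Let $d\in\mathbb{R}^N$, let $x_{\mathrm{TSVD}}=K_{\mathrm{TSVD}}^\dagger d=V_k\Sigma_k^{-1}U_k^Td$ be the TSVD filtered solution, assumed nonzero, let $\widehat x_{\mathrm{TSVD}}=\widehat K_{\mathrm{TSVD}}^\dagger d$ be the approximate TSVD solution, and define the residual $r=d-Kx_{\mathrm{TSVD}}$. With $\varphi=(1+\sqrt5)/2$, $$\frac{\left\|x_{\mathrm{TSVD}}-\widehat x_{\mathrm{TSVD}}\right\|}{\left\|x_{\mathrm{TSVD}}\right\|}\le\frac{\varphi\,\sigma_1}{\sigma_k\,\widehat\sigma_k\sqrt{1-\frac{\|r\|^2}{\|d\|^2}}}\left(\sigma_1\|V_k^T\widehat V_0\|+\|\widehat W_{21}\|\right).$$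
   Context: All matrix norms are spectral (2-)norms and vector norms are Euclidean. $^\dagger$ is the Moore–Penrose pseudoinverse. $\otimes$ is the Kronecker product, $(A\otimes B)=[a_{ij}B]$ in block form. True SVD: $K=U\Sigma V^T$ with $U,V$ orthogonal and $\Sigma=\mathrm{diag}(\sigma_1,\dots,\sigma_N)$, $\sigma_1\ge\cdots\ge\sigma_N\ge0$. $U_k,V_k$ are the first $k$ columns of $U,V$; $U_0,V_0$ are the remaining $N-k$ columns; $\Sigma_k=\mathrm{diag}(\sigma_1,\dots,\sigma_k)$. Kronecker sum decomposition: $K=\sum_{i=1}^R A_i\otimes B_i$ with $A_i,B_i\in\mathbb{R}^{n\times n}$, where $R$ is the Kronecker rank of $K$ (the least number of terms for which such an exact decomposition exists). It is obtained as follows. Let $\widetilde K$ be the $n^2\times n^2$ rearrangement of $K$, the linear rearrangement of entries such that $\widetilde K=\mathrm{vec}(A)\mathrm{vec}(B)^T$ whenever $K=A\otimes B$ with $A,B\in\mathbb{R}^{n\times n}$ ($\mathrm{vec}$ stacks columns). If $\widetilde K=\sum_{i=1}^R s_i u_iv_i^T$ is an SVD with $s_1\ge\dots\ge s_R>0$, then $\mathrm{vec}(A_i)=\sqrt{s_i}\,u_i$ and $\mathrm{vec}(B_i)=\sqrt{s_i}\,v_i$. Construction of the approximation: Let $A_1=U_A\Sigma_AV_A^T$ and $B_1=U_B\Sigma_BV_B^T$ be SVDs. Put $U_1=U_A\otimes U_B$, $\Sigma_1=\Sigma_A\otimes\Sigma_B$, $V_1=V_A\otimes V_B$, and $W=U_1^T\left(\sum_{i=2}^R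 A_i\otimes B_i\right)V_1$, so that $K=U_1(\Sigma_1+W)V_1^T$. Let $P$ be a permutation matrix such that the diagonal of $P^T\Sigma_1P=\mathrm{diag}(\sigma_{1,1},\dots,\sigma_{1,N})$ is in descending order. Put $\Sigma_{1,k}=\mathrm{diag}(\sigma_{1,1},\dots,\sigma_{1,k})$ and $\widehat\Sigma_0=\mathrm{diag}(\sigma_{1,k+1},\dots,\sigma_{1,N})$, and partition conformally $$P^TWP=\begin{bmatrix}W_{11}&W_{12}\\ W_{21}&W_{22}\end{bmatrix},\qquad W_{11}\in\mathbb{R}^{k\times k}.$$ Let $\Sigma_{1,k}+W_{11}=\widehat U_t\widehat\Sigma_t\widehat V_t^T$ be an SVD of this $k\times k$ matrix, with $\widehat\Sigma_k:=\widehat\Sigma_t=\mathrm{diag}(\widehat\sigma_1,\dots,\widehat\sigma_k)$, $\widehat\sigma_1\ge\dots\ge\widehat\sigma_k\ge0$ (the approximate singular values). Define $\widehat W_{12}=\widehat U_t^TW_{12}$, $\widehat W_{21}=W_{21}\widehat V_t$, $$\widehat U=U_1P\begin{bmatrix}\widehat U_t&0\\0&I\end{bmatrix},\qquad \widehat V=V_1P\begin{bmatrix}\widehat V_t&0\\0&I\end{bmatrix},$$ so that $$K=\widehat U\left(\begin{bmatrix}\widehat\Sigma_k&0\\0&\widehat\Sigma_0\end{bmatrix}+\begin{bmatrix}0&\widehat W_{12}\\ \widehat W_{21}&W_{22}\end{bmatrix}\right)\widehat V^T.$$ $\widehat U_k,\widehat V_k$ are the first $k$ columns of $\widehat U,\widehat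 V$, and $\widehat U_0,\widehat V_0$ the remaining $N-k$ columns. *)

(* Defs.v *)
From mathcomp Require Export all_boot all_order all_algebra.
From mathcomp Require Export all_classical all_reals.
From mathcomp Require Export mxtens.

Set Implicit Arguments.
Unset Strict Implicit.
Unset Printing Implicit Defensive.

Import Order.TTheory GRing.Theory Num.Theory.
Local Open Scope classical_set_scope.
Local Open Scope ring_scope.

(* Conventions: finite lists of scalars (singular values) and of matrices are
   represented by functions on nat, of which only the first entries matter.
   Indices start at 0, so that sigma_1 is [sigma 0] and sigma_k is
   [sigma k.-1]. *)

Definition enorm {R : realType} {m : nat} (x : 'cV[R]_m) : R :=
  Num.sqrt (\sum_(i < m) x i 0 ^+ 2).

(* The set is nonempty (it contains 0) and bounded above, so that [sup] is a
   genuine least upper bound. *)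
Definition specnorm {R : realType} {m n : nat} (A : 'M[R]_(m, n)) : R :=
  sup [set enorm (A *m x) | x in [set x : 'cV[R]_n | enorm x <= 1]].

Definition orthogonal_mx {R : realType} {n : nat} (Q : 'M[R]_n) : Prop :=
  Q^T *m Q = 1%:M.

Definition diag {R : realType} (n : nat) (s : nat -> R) : 'M[R]_n :=
  diag_mx (\row_(i < n) s i).

Definition nonincreasing_upto {R : realType} (n : nat) (s : nat -> R) : Prop :=
  forall i j : nat, (i <= j < n)%N -> s j <= s i.

Definition is_svd {R : realType} {n : nat} (A U : 'M[R]_n) (s : nat -> R)
    (V : 'M[R]_n) : Prop :=
  [/\ orthogonal_mx U, orthogonal_mx V, nonincreasing_upto n s,
      forall i : nat, (i < n)%N -> 0 <= s i
    & A = U *m diag n s *m V^T].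

Definition orthonormal_upto {R : realType} {m : nat} (r : nat)
    (u : nat -> 'cV[R]_m) : Prop :=
  forall i j : nat, (i < r)%N -> (j < r)%N ->
    (u i)^T *m u j = (i == j)%:R%:M.

(* A = sum_(i < r) s_i u_i v_i^T with s_0 >= ... >= s_(r-1) > 0. *)
Definition is_compact_svd {R : realType} {m n : nat} (A : 'M[R]_(m, n))
    (r : nat) (s : nat -> R) (u : nat -> 'cV[R]_m) (v : nat -> 'cV[R]_n) :
    Prop :=
  [/\ orthonormal_upto r u, orthonormal_upto r v, nonincreasing_upto r s,
      forall i : nat, (i < r)%N -> 0 < s i
    & A = \sum_(0 <= i < r) s i *: (u i *m (v i)^T)].

Definition is_pinv {R : realType} {m n : nat} (A : 'M[R]_(m, n))
    (X : 'M[R]_(n, m)) : Prop :=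
  [/\ A *m X *m A = A, X *m A *m X = X,
      (A *m X)^T = A *m X & (X *m A)^T = X *m A].

(* Not [pinvmx], which is a one-sided partial inverse. The default value 0 of
   [xget] is never used for a matrix that has an SVD, i.e. for any matrix. *)
Definition mpinv {R : realType} {m n : nat} (A : 'M[R]_(m, n)) :
    'M[R]_(n, m) :=
  xget 0 [set X | is_pinv A X].

(* [A *t B] is the Kronecker product, with
   [(A *t B) (i * p + j, k * q + l) = A i k * B j l] for B of size p x q. *)

Definition kron_sum {R : realType} {n : nat} (lo hi : nat)
    (A B : nat -> 'M[R]_n) : 'M[R]_(n * n) :=
  \sum_(lo <= i < hi) (A i *t B i).

Definition is_kronecker_rank {R : realType} {n : nat} (K : 'M[R]_(n * n))
    (r : nat) : Prop :=
  (exists A B : nat -> 'M[R]_n, K = kron_sum 0 r A B) /\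
  (forall (q : nat) (A B : nat -> 'M[R]_n), K = kron_sum 0 q A B -> (r <= q)%N).

(* Column stacking: entry (i, j) goes to position j * n + i. *)
Definition vec {R : realType} {n : nat} (A : 'M[R]_n) : 'cV[R]_(n * n) :=
  \col_a A (mxtens_unindex a).2 (mxtens_unindex a).1.

(* The entry of K in position (i2, j2) of the block (i1, j1) is moved to the
   row indexed by (i1, j1) and the column indexed by (i2, j2), both in the
   column stacking order of [vec]. *)
Definition rearrange {R : realType} {n : nat} (K : 'M[R]_(n * n)) :
    'M[R]_(n * n) :=
  \matrix_(a, b)
    K (mxtens_index ((mxtens_unindex a).2, (mxtens_unindex b).2))
      (mxtens_index ((mxtens_unindex a).1, (mxtens_unindex b).1)).

(* Partitions of N x N matrices along an equation N = k + m. *)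
Section Partition.
Context {R : realType} {N k m : nat} (e : (k + m)%N = N).

Definition cols_l (X : 'M[R]_N) : 'M[R]_(N, k) :=
  lsubmx (castmx (erefl N, esym e) X).
Definition cols_r (X : 'M[R]_N) : 'M[R]_(N, m) :=
  rsubmx (castmx (erefl N, esym e) X).
Definition block11 (X : 'M[R]_N) : 'M[R]_k :=
  ulsubmx (castmx (esym e, esym e) X).
Definition block21 (X : 'M[R]_N) : 'M[R]_(m, k) :=
  dlsubmx (castmx (esym e, esym e) X).
Definition pad1 (Q : 'M[R]_k) : 'M[R]_N :=
  castmx (e, e) (block_mx Q 0 0 1%:M).
End Partition.

Definition golden_ratio {R : realType} : R := (1 + Num.sqrt 5) / 2.

Lemma rearrange_tens (R : realType) (n : nat) (A B : 'M[R]_n) :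
  rearrange (A *t B) = vec A *m (vec B)^T.
Proof.
by apply/matrixP=> a b; rewrite !mxE big_ord1 !mxE !mxtens_indexK.
Qed.

Lemma rearrange_linear (R : realType) (n : nat) :
  linear (@rearrange R n).
Proof. by move=> c K L; apply/matrixP=> a b; rewrite !mxE. Qed.

Lemma is_pinv_unique (R : realType) (m n : nat) (A : 'M[R]_(m, n))
    (X Y : 'M[R]_(n, m)) :
  is_pinv A X -> is_pinv A Y -> X = Y.
Proof.
move=> [AXA XAX sAX sXA] [AYA YAY sAY sYA].
have eAX : A *m X = A *m Y.
  rewrite -sAX -{1}AYA -mulmxA trmx_mul sAX sAY mulmxA.
  by rewrite AXA.
have eXA : X *m A = Y *m A.
  rewrite -sXA -{1}AYA -(mulmxA A) mulmxA trmx_mul sXA sYA.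
  by rewrite -mulmxA (mulmxA A) AXA.
by rewrite -XAX eXA -mulmxA eAX mulmxA YAY.
Qed.

Lemma mpinv_eq (R : realType) (m n : nat) (A : 'M[R]_(m, n))
    (X : 'M[R]_(n, m)) :
  is_pinv A X -> mpinv A = X.
Proof.
move=> hX; apply: (is_pinv_unique _ hX).
by rewrite /mpinv; case: xgetP => [Y -> //|/(_ X)].
Qed.

Lemma mpinv_tsvd (R : realType) (N k : nat) (U V : 'M[R]_(N, k))
    (s : nat -> R) :
  U^T *m U = 1%:M -> V^T *m V = 1%:M ->
  (forall i : nat, (i < k)%N -> 0 < s i) ->
  mpinv (U *m diag k s *m V^T) = V *m invmx (diag k s) *m U^T.
Proof.
move=> hU hV hs.
have uS : diag k s \in unitmx.
  rewrite unitmxE det_diag unitfE; apply/prodf_neq0 => i _.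
  by rewrite mxE gt_eqF ?hs.
have AX : U *m diag k s *m V^T *m (V *m invmx (diag k s) *m U^T) = U *m U^T.
  rewrite !mulmxA -(mulmxA _ V^T V) hV mulmx1 -(mulmxA U).
  by rewrite mulmxV // mulmx1.
have XA : V *m invmx (diag k s) *m U^T *m (U *m diag k s *m V^T) = V *m V^T.
  rewrite !mulmxA -(mulmxA _ U^T U) hU mulmx1 -(mulmxA V).
  by rewrite mulVmx // mulmx1.
apply: mpinv_eq; split; rewrite ?AX ?XA ?trmx_mul ?trmxK //.
  by rewrite !mulmxA -(mulmxA U U^T U) hU mulmx1.
by rewrite !mulmxA -(mulmxA V V^T V) hV mulmx1.
Qed.

(* Main.v *)
Require Import Defs.
From mathcomp Require Import all_boot all_order all_algebra.
From mathcomp Require Import all_classical all_reals.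
From mathcomp Require Import mxtens fingroup perm.
From mathcomp Require Import ring lra.

(** Both truncated operators have rank k with a known factorization X S Y^T,
    where X and Y have orthonormal columns and S is diagonal and invertible, so
    the pseudoinverses are Y S^-1 X^T. The bound multiplies three estimates.

    - Distance of the operators ([tsvd_diff_bound]). From K V_k = U_k Sigma_k
      and K Vh_k = Uh_k Sigmah_k + Uh_0 Wh_21 one gets
      K_TSVD - Kh_TSVD = K (V_k V_k^T - Vh_k Vh_k^T) + Uh_0 Wh_21 Vh_k^T. The
      difference of two orthogonal projections of equal rank is as small as the
      cosines V_k^T Vh_0 between the range of one and the complement of the
      other ([proj_diff_bound]); hence the factor
      eps = sigma_1 |V_k^T Vh_0| + |Wh_21|.

    - Perturbation of the pseudoinverse ([wedin_pinv], after Wedin). The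
      difference of the pseudoinverses is at most
      phi |A^+| |B^+| |A - B|, with |A^+| = 1 / sigma_k and
      |B^+| = 1 / sigmah_k. In suitable orthogonal splittings of the domain and
      the codomain the difference has three nonzero blocks out of four, each
      bounded by |A^+| |B^+| |A - B|, and phi is the norm of the matrix
      [[1, 1], [1, 0]].

    - Size of the solution. The residual is the component of d orthogonal to
      the range of U_k, so that sqrt (1 - |r|^2 / |d|^2) = |U_k^T d| / |d|
      ([residual_ratio]), while U_k^T d = Sigma_k V_k^T x gives
      |U_k^T d| <= sigma_1 |x|.

    Equality of ranks enters through [coproj_swap]: for two subspaces of the
    same dimension the largest angle is symmetric. The Kronecker structure only
    serves to establish K Vh_k = Uh_k Sigmah_k + Uh_0 Wh_21. *)

Set Implicit Arguments.
Unset Strict Implicit.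
Unset Printing Implicit Defensive.

Import Order.TTheory GRing.Theory Num.Theory.
Local Open Scope ring_scope.

(** * Euclidean norm and operator bounds *)

Section Euclidean.
Context {R : realType}.

Definition dot {m : nat} (x y : 'cV[R]_m) : R := (x^T *m y) 0 0.

Lemma dotE m (x y : 'cV[R]_m) : dot x y = \sum_i x i 0 * y i 0.
Proof. by rewrite /dot mxE; apply: eq_bigr => i _; rewrite mxE. Qed.

Lemma dotC m (x y : 'cV[R]_m) : dot x y = dot y x.
Proof. by rewrite !dotE; apply: eq_bigr => i _; rewrite mulrC. Qed.

Lemma dotDr m (x y z : 'cV[R]_m) : dot x (y + z) = dot x y + dot x z.
Proof. by rewrite /dot mulmxDr mxE. Qed.

Lemma dotDl m (x y z : 'cV[R]_m) : dot (y + z) x = dot y x + dot z x.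
Proof. by rewrite dotC dotDr !(dotC x). Qed.

Lemma dotZr m c (x y : 'cV[R]_m) : dot x (c *: y) = c * dot x y.
Proof. by rewrite /dot -scalemxAr mxE. Qed.

Lemma dotZl m c (x y : 'cV[R]_m) : dot (c *: x) y = c * dot x y.
Proof. by rewrite dotC dotZr dotC. Qed.

Lemma dot_adj m n (A : 'M[R]_(m, n)) x y : dot (A *m x) y = dot x (A^T *m y).
Proof. by rewrite /dot trmx_mul mulmxA. Qed.

Lemma dot_ge0 m (x : 'cV[R]_m) : 0 <= dot x x.
Proof. by rewrite dotE sumr_ge0 // => i _; rewrite -expr2 sqr_ge0. Qed.

Lemma enormE m (x : 'cV[R]_m) : enorm x = Num.sqrt (dot x x).
Proof. by rewrite dotE; congr Num.sqrt; apply: eq_bigr => i _; rewrite expr2. Qed.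

Lemma enorm_ge0 m (x : 'cV[R]_m) : 0 <= enorm x.
Proof. exact: sqrtr_ge0. Qed.

Lemma enorm_sqr m (x : 'cV[R]_m) : enorm x ^+ 2 = dot x x.
Proof. by rewrite enormE sqr_sqrtr ?dot_ge0. Qed.

Lemma enorm_eq0 m (x : 'cV[R]_m) : (enorm x == 0) = (x == 0).
Proof.
rewrite enormE sqrtr_eq0 le_eqVlt ltNge dot_ge0 orbF dotE.
apply/idP/eqP => [|->]; last by rewrite big1 // => i _; rewrite mxE mul0r.
rewrite psumr_eq0 => [/allP h|i _]; last by rewrite -expr2 sqr_ge0.
apply/colP => i; rewrite [RHS]mxE; apply/eqP.
by have := h i (mem_index_enum _); rewrite /= mulf_eq0 orbb.
Qed.

Lemma enorm_gt0 m (x : 'cV[R]_m) : (0 < enorm x) = (x != 0).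
Proof. by rewrite lt_def enorm_ge0 andbT enorm_eq0. Qed.

Lemma enorm_le m n (x : 'cV[R]_m) (y : 'cV[R]_n) (c : R) :
  0 <= c -> dot x x <= c ^+ 2 * dot y y -> enorm x <= c * enorm y.
Proof.
move=> c0; rewrite -!enorm_sqr -exprMn.
by rewrite ler_pXn2r // nnegrE ?mulr_ge0 ?enorm_ge0.
Qed.

Lemma enormZ m c (x : 'cV[R]_m) : enorm (c *: x) = `|c| * enorm x.
Proof.
by rewrite !enormE dotZl dotZr mulrA -expr2 sqrtrM ?sqr_ge0 // sqrtr_sqr.
Qed.

Lemma enorm0 m : enorm (0 : 'cV[R]_m) = 0.
Proof. by apply/eqP; rewrite enorm_eq0. Qed.

Lemma enormN m (x : 'cV[R]_m) : enorm (- x) = enorm x.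
Proof. by rewrite -scaleN1r enormZ normrN1 mul1r. Qed.

Lemma cauchy_schwarz m (x y : 'cV[R]_m) : dot x y <= enorm x * enorm y.
Proof.
have [->|y0] := eqVneq y 0.
  by rewrite -[0](scale0r 0) dotZr mul0r mulr_ge0 ?enorm_ge0.
have yy : 0 < dot y y by rewrite -enorm_sqr exprn_gt0 // enorm_gt0.
have sq : dot x y ^+ 2 <= dot x x * dot y y.
  (* the component of x orthogonal to y, scaled by dot y y *)
  have := dot_ge0 (dot y y *: x + (- dot x y) *: y).
  rewrite !(dotDl, dotDr, dotZl, dotZr) (dotC y x) => h.
  rewrite -subr_ge0 -(pmulr_rge0 _ yy).
  by apply: le_trans h _; rewrite le_eqVlt; apply/orP; left; apply/eqP; ring.
have [le0|gt0] := leP (dot x y) 0.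
  by apply: le_trans le0 _; rewrite mulr_ge0 ?enorm_ge0.
rewrite -(ler_pXn2r (n := 2)) // ?nnegrE ?mulr_ge0 ?enorm_ge0 ?(ltW gt0) //.
by rewrite exprMn !enorm_sqr.
Qed.

Lemma enormD m (x y : 'cV[R]_m) : enorm (x + y) <= enorm x + enorm y.
Proof.
rewrite -(ler_pXn2r (n := 2)) // ?nnegrE ?addr_ge0 ?enorm_ge0 //.
rewrite enorm_sqr sqrrD !enorm_sqr !(dotDl, dotDr) (dotC y x).
by have := cauchy_schwarz x y; lra.
Qed.

Lemma pythagoras m (x y : 'cV[R]_m) :
  dot x y = 0 -> dot (x + y) (x + y) = dot x x + dot y y.
Proof. by move=> h; rewrite !(dotDl, dotDr) (dotC y) h addr0 add0r. Qed.

Lemma dot_isom m n (Q : 'M[R]_(m, n)) x y :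
  Q^T *m Q = 1%:M -> dot (Q *m x) (Q *m y) = dot x y.
Proof. by move=> h; rewrite dot_adj mulmxA h mul1mx. Qed.

Lemma enorm_isom m n (Q : 'M[R]_(m, n)) x :
  Q^T *m Q = 1%:M -> enorm (Q *m x) = enorm x.
Proof. by move=> h; rewrite !enormE dot_isom. Qed.

(** A bound on the spectral norm, stated without the supremum: it composes by
    chaining inequalities, and [opbound_specnorm] turns the supremum into it. *)
Definition opbound {m n : nat} (A : 'M[R]_(m, n)) (c : R) : Prop :=
  forall x : 'cV[R]_n, enorm (A *m x) <= c * enorm x.

Lemma opboundD m n (A B : 'M[R]_(m, n)) a b :
  opbound A a -> opbound B b -> opbound (A + B) (a + b).
Proof.
move=> hA hB x; rewrite mulmxDl mulrDl.
exact: le_trans (enormD _ _) (lerD (hA x) (hB x)).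
Qed.

Lemma opboundN m n (A : 'M[R]_(m, n)) a : opbound A a -> opbound (- A) a.
Proof. by move=> hA x; rewrite mulNmx enormN. Qed.

Lemma opboundM m n p (A : 'M[R]_(m, n)) (B : 'M[R]_(n, p)) a b :
  0 <= a -> opbound A a -> opbound B b -> opbound (A *m B) (a * b).
Proof.
move=> a0 hA hB x; rewrite -mulmxA; apply: le_trans (hA _) _.
by rewrite -mulrA ler_wpM2l.
Qed.

Lemma opbound_isom m n (Q : 'M[R]_(m, n)) : Q^T *m Q = 1%:M -> opbound Q 1.
Proof. by move=> h x; rewrite enorm_isom // mul1r. Qed.

(** A matrix and its transpose have the same norm:
    |A^T y|^2 = <y, A A^T y> <= |y| a |A^T y|. *)
Lemma opboundT m n (A : 'M[R]_(m, n)) a :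
  0 <= a -> opbound A a -> opbound A^T a.
Proof.
move=> a0 hA y.
have [z|nz] := eqVneq (A^T *m y) 0.
  by rewrite z enorm0 mulr_ge0 ?enorm_ge0.
rewrite -(ler_pM2r (x := enorm (A^T *m y))) ?enorm_gt0 //.
rewrite -expr2 enorm_sqr dot_adj trmxK.
apply: le_trans (cauchy_schwarz _ _) _; rewrite -mulrA mulrCA.
by rewrite ler_wpM2l ?enorm_ge0.
Qed.

Lemma opbound_diag n (s : nat -> R) c :
  0 <= c -> (forall i : nat, (i < n)%N -> `|s i| <= c) -> opbound (diag n s) c.
Proof.
move=> c0 h x; apply: enorm_le => //.
rewrite !dotE mulr_sumr; apply: ler_sum => i _.
rewrite /diag mul_diag_mx !mxE -!expr2 exprMn ler_wpM2r ?sqr_ge0 //.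
by rewrite -[s i ^+ 2]real_normK ?num_real // ler_pXn2r ?nnegrE ?h.
Qed.

(** The Frobenius norm is a bound; only the finiteness of the supremum that
    defines the spectral norm depends on it. *)
Lemma opbound_exists m n (A : 'M[R]_(m, n)) : exists2 c, 0 <= c & opbound A c.
Proof.
exists (Num.sqrt (\sum_i dot (row i A)^T (row i A)^T)); first exact: sqrtr_ge0.
move=> x; apply: enorm_le; first exact: sqrtr_ge0.
rewrite sqr_sqrtr; last by apply: sumr_ge0 => i _; exact: dot_ge0.
rewrite mulr_suml dotE; apply: ler_sum => i _; rewrite -expr2.
have -> : (A *m x) i 0 = dot (row i A)^T x.
  by rewrite /dot trmxK -row_mul [RHS]mxE.
set y := (row i A)^T.
have hle := cauchy_schwarz y x.
have hge := cauchy_schwarz (- y) x.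
rewrite -scaleN1r dotZl enormZ normrN1 mul1r mulN1r in hge.
rewrite -!enorm_sqr -exprMn -[_ ^+ 2 in leLHS]real_normK ?num_real //.
rewrite ler_pXn2r ?nnegrE ?mulr_ge0 ?enorm_ge0 //.
by rewrite ler_norml hle andbT lerNl.
Qed.

Lemma specnorm_has_sup m n (A : 'M[R]_(m, n)) :
  has_sup [set enorm (A *m x) | x in [set x : 'cV[R]_n | enorm x <= 1]]%classic.
Proof.
split.
  by exists (enorm (A *m 0)); exists 0 => //=; rewrite enorm0.
have [c c0 hc] := opbound_exists A.
exists c => _ [x /= x1 <-]; apply: le_trans (hc x) _.
by rewrite ler_piMr.
Qed.

Lemma specnorm_ge0 m n (A : 'M[R]_(m, n)) : 0 <= specnorm A.
Proof.
apply: ub_le_sup; first by case: (specnorm_has_sup A).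
by exists 0 => /=; rewrite ?mulmx0 enorm0.
Qed.

Lemma opbound_specnorm m n (A : 'M[R]_(m, n)) : opbound A (specnorm A).
Proof.
move=> x; have [->|nz] := eqVneq x 0.
  by rewrite mulmx0 !enorm0 mulr0.
have x0 : 0 < enorm x by rewrite enorm_gt0.
rewrite -ler_pdivrMr //; apply: ub_le_sup; first by case: (specnorm_has_sup A).
exists ((enorm x)^-1 *: x) => /=.
  by rewrite enormZ ger0_norm ?invr_ge0 ?enorm_ge0 // mulVf ?gt_eqF.
by rewrite -scalemxAr enormZ ger0_norm ?invr_ge0 ?enorm_ge0 // mulrC.
Qed.
End Euclidean.

(** * Orthogonal projections and pseudoinverses *)

Section Projections.
Context {R : realType}.

(** For X with orthonormal columns, the orthogonal projection onto the
    complement of the range of X. *)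
Definition coproj {m k : nat} (X : 'M[R]_(m, k)) : 'M[R]_m := 1%:M - X *m X^T.

Lemma coprojT m k (X : 'M[R]_(m, k)) : (coproj X)^T = coproj X.
Proof. by rewrite /coproj linearB /= trmx1 trmx_mul trmxK. Qed.

Lemma coproj_annihil m k (X : 'M[R]_(m, k)) :
  X^T *m X = 1%:M -> coproj X *m X = 0.
Proof. by move=> h; rewrite mulmxBl mul1mx -mulmxA h mulmx1 subrr. Qed.

Lemma annihil_coproj m k (X : 'M[R]_(m, k)) :
  X^T *m X = 1%:M -> X^T *m coproj X = 0.
Proof. by move=> h; rewrite mulmxBr mulmx1 mulmxA h mul1mx subrr. Qed.

Lemma coproj_idem m k (X : 'M[R]_(m, k)) :
  X^T *m X = 1%:M -> coproj X *m coproj X = coproj X.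
Proof.
move=> h; rewrite {2}/coproj mulmxBr mulmx1 mulmxA.
by rewrite coproj_annihil // mul0mx subr0.
Qed.

Lemma proj_split m k (X : 'M[R]_(m, k)) (z : 'cV[R]_m) :
  X^T *m X = 1%:M ->
  dot (X^T *m z) (X^T *m z) + dot (coproj X *m z) (coproj X *m z) = dot z z.
Proof.
move=> h; have {5 6}-> : z = X *m (X^T *m z) + coproj X *m z.
  by rewrite mulmxA -mulmxDl addrC subrK mul1mx.
rewrite pythagoras ?(dot_isom _ _ h) //.
by rewrite dot_adj mulmxA annihil_coproj // mul0mx /dot mulmx0 mxE.
Qed.

(** The largest principal angle between two subspaces of equal dimension is
    symmetric. With C = X^T Y, which is square, |(1 - X X^T) Y z| <= t |z|
    says |C z|^2 >= (1 - t^2) |z|^2, and the claim says the same of C^T. If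
    t >= 1 there is nothing to prove; otherwise C is injective, hence
    invertible, and the bound on its inverse passes to the transpose. *)
Lemma coproj_swap m k (X Y : 'M[R]_(m, k)) t :
  X^T *m X = 1%:M -> Y^T *m Y = 1%:M -> 0 <= t ->
  opbound (coproj X *m Y) t -> opbound (coproj Y *m X) t.
Proof.
move=> hX hY t0 hb.
have le_dot p q (u : 'cV[R]_p) (v : 'cV[R]_q) c :
    0 <= c -> enorm u <= c * enorm v -> dot u u <= c ^+ 2 * dot v v.
  move=> c0 h; rewrite -!enorm_sqr -exprMn.
  by rewrite ler_pXn2r ?nnegrE ?mulr_ge0 ?enorm_ge0.
have lowX z : (1 - t ^+ 2) * dot z z <= dot (X^T *m Y *m z) (X^T *m Y *m z).
  have := proj_split (Y *m z) hX; rewrite (dot_isom _ _ hY) !mulmxA.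
  by have := le_dot _ _ _ _ _ t0 (hb z); lra.
suff lowY z : (1 - t ^+ 2) * dot z z <= dot (Y^T *m X *m z) (Y^T *m X *m z).
  move=> z; apply: enorm_le => //.
  have := proj_split (X *m z) hY; rewrite (dot_isom _ _ hX) !mulmxA.
  by have := lowY z; lra.
have [le0|gt0] := leP (1 - t ^+ 2) 0.
  by apply: le_trans (dot_ge0 _); rewrite mulr_le0_ge0 ?dot_ge0.
set C := X^T *m Y in lowX *.
have -> : Y^T *m X = C^T by rewrite trmx_mul trmxK.
pose c := Num.sqrt (1 - t ^+ 2).
have c0 : 0 < c by rewrite sqrtr_gt0.
have c2 : c ^+ 2 = 1 - t ^+ 2 by rewrite sqr_sqrtr ?ltW.
have uC : C \in unitmx.
  rewrite -unitmx_tr -row_free_unit -kermx_eq0; apply/eqP/row_matrixP => i.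
  rewrite row0; apply/trmx_inj; rewrite trmx0; apply/eqP.
  (* a vector of the kernel of C has norm 0 by the lower bound *)
  have := lowX (row i (kermx C^T))^T.
  have -> : C *m (row i (kermx C^T))^T = 0.
    by apply: trmx_inj; rewrite trmx_mul trmxK trmx0 -row_mul mulmx_ker row0.
  rewrite {2}/dot mulmx0 mxE pmulr_rle0 // => h.
  by rewrite -enorm_eq0 -sqrf_eq0 enorm_sqr eq_le h dot_ge0.
have bC : opbound (invmx C)^T c^-1.
  apply: opboundT; first by rewrite invr_ge0 ltW.
  move=> w; apply: enorm_le; first by rewrite invr_ge0 ltW.
  have := lowX (invmx C *m w); rewrite mulKVmx // -c2 => h.
  by rewrite exprVn ler_pdivlMl ?exprn_gt0.
have := le_dot _ _ _ _ _ _ (bC (C^T *m z)).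
rewrite mulmxA -trmx_mul mulmxV // trmx1 mul1mx exprVn => h.
by rewrite -c2 -ler_pdivlMl ?exprn_gt0 // h // invr_ge0 ltW.
Qed.

(** With P, Q the projections onto the ranges of X and Y, the two terms of
    P - Q = P (1 - Q) - (1 - P) Q have orthogonal ranges and act on orthogonal
    components of the argument, so the norm is the larger of the two norms,
    and these agree by [coproj_swap]. *)
Lemma proj_diff_bound m k (X Y : 'M[R]_(m, k)) t :
  X^T *m X = 1%:M -> Y^T *m Y = 1%:M -> 0 <= t ->
  opbound (X^T *m coproj Y) t -> opbound (X *m X^T - Y *m Y^T) t.
Proof.
move=> hX hY t0 hb.
have hb' : opbound (coproj X *m Y) t.
  apply: coproj_swap => //.
  by rewrite -coprojT -[X]trmxK -trmx_mul; apply: opboundT.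
have -> : X *m X^T - Y *m Y^T = X *m (X^T *m coproj Y) - coproj X *m Y *m Y^T.
  rewrite /coproj mulmxBr mulmx1 mulmxBl mul1mx mulmxBl mulmxBr !mulmxA.
  by rewrite opprB addrA subrK.
move=> z; apply: enorm_le => //.
rewrite mulmxBl -mulNmx pythagoras; last first.
  rewrite -!mulmxA mulNmx dot_adj mulmxN -!mulmxA (mulmxA X^T (coproj X)).
  by rewrite annihil_coproj // mul0mx oppr0 /dot mulmx0 mxE.
rewrite mulNmx -!enorm_sqr enormN -!mulmxA enorm_isom // -(coproj_idem hY).
rewrite -[coproj Y *m _ *m z]mulmxA (mulmxA X^T).
set w := coproj Y *m z; set w' := Y^T *m z.
have h1 := hb w; have h2 := hb' w'; rewrite -!mulmxA in h1 h2 *.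
rewrite !enorm_sqr -(proj_split z hY) mulrDr [leRHS]addrC -!enorm_sqr -!exprMn.
by rewrite lerD // ler_pXn2r ?nnegrE ?mulr_ge0 ?enorm_ge0.
Qed.

(** A perturbation bound for the range: with A = X1 S1 Y1^T and
    B = X2 S2 Y2^T, the projection 1 - X2 X2^T annihilates B, so applied to
    X1 = A Y1 S1^-1 it gives (1 - X2 X2^T) (A - B) Y1 S1^-1. *)
Lemma sin_theta m n k (X1 X2 : 'M[R]_(m, k)) (Y1 Y2 : 'M[R]_(n, k))
    (S1 S2 : 'M[R]_k) a eps :
  X2^T *m X2 = 1%:M -> Y1^T *m Y1 = 1%:M ->
  X1^T *m X1 = 1%:M -> S1 \in unitmx -> opbound (invmx S1) a -> 0 <= eps ->
  opbound (X1 *m S1 *m Y1^T - X2 *m S2 *m Y2^T) eps ->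
  opbound (coproj X2 *m X1) (a * eps).
Proof.
move=> hX2 hY1 hX1 uS bS eps0 bE.
have -> : coproj X2 *m X1 =
    coproj X2 *m ((X1 *m S1 *m Y1^T - X2 *m S2 *m Y2^T) *m Y1 *m invmx S1).
  have -> : (X1 *m S1 *m Y1^T - X2 *m S2 *m Y2^T) *m Y1 *m invmx S1 =
      X1 - X2 *m (S2 *m Y2^T *m Y1 *m invmx S1).
    rewrite !mulmxBl !mulmxA; congr (_ - _).
    by rewrite -!mulmxA (mulmxA Y1^T) hY1 mul1mx mulmxV // mulmx1.
  by rewrite mulmxBr [X in _ - X]mulmxA coproj_annihil // mul0mx subr0.
have bP : opbound (coproj X2) 1.
  move=> z; apply: enorm_le => //; rewrite expr1n mul1r -(proj_split z hX2).
  by rewrite lerDr dot_ge0.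
rewrite mulrC -[_ * a]mul1r; apply: opboundM => //.
apply: opboundM => //.
by rewrite -[eps]mulr1; apply: opboundM => //; apply: opbound_isom.
Qed.

Lemma golden_ratio_sqr : (golden_ratio : R) ^+ 2 = golden_ratio + 1.
Proof.
rewrite /golden_ratio; have := @sqr_sqrtr R 5 (ler0n _ _).
by set q := Num.sqrt 5 => h; field: h.
Qed.

Lemma golden_ratio_gt0 : 0 < (golden_ratio : R).
Proof. by rewrite /golden_ratio divr_gt0 // ltr_wpDr ?sqrtr_ge0. Qed.

(** The golden ratio is the norm of the matrix [[1, 1], [1, 0]]. *)
Lemma golden_ratio_form (p q : R) :
  (p + q) ^+ 2 + p ^+ 2 <= golden_ratio ^+ 2 * (p ^+ 2 + q ^+ 2).
Proof.
have f2 := golden_ratio_sqr; have f0 := golden_ratio_gt0.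
rewrite -subr_ge0 -(pmulr_rge0 _ f0).
(* multiplied by the golden ratio, the gap is a perfect square *)
suff -> : golden_ratio * (golden_ratio ^+ 2 * (p ^+ 2 + q ^+ 2)
     - ((p + q) ^+ 2 + p ^+ 2)) = (p - golden_ratio * q) ^+ 2 by apply: sqr_ge0.
by ring: f2.
Qed.

(** Write A, B for the two factored matrices, A^+ and B^+ for their
    pseudoinverses, E = A - B, P for the projection onto the range of A and Q
    for the projection onto the row space of B. Then
    A^+ - B^+ = (1 - Q) A^+ - B^+ E A^+ - B^+ (1 - P).
    The first term has values in the complement of the row space of B, the
    others in that row space; the first two see only the component of the
    argument in the range of A, the last only the orthogonal one. By
    [sin_theta] and [coproj_swap] each term is at most c = a b eps, so the
    squared norm is at most c^2 ((p + q)^2 + p^2), where p and q are the norms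
    of the two components. *)
Lemma wedin_pinv m n k (X1 X2 : 'M[R]_(m, k)) (Y1 Y2 : 'M[R]_(n, k))
    (S1 S2 : 'M[R]_k) a b eps :
  X1^T *m X1 = 1%:M -> X2^T *m X2 = 1%:M ->
  Y1^T *m Y1 = 1%:M -> Y2^T *m Y2 = 1%:M ->
  S1 \in unitmx -> S2 \in unitmx -> 0 <= a -> 0 <= b -> 0 <= eps ->
  opbound (invmx S1) a -> opbound (invmx S2) b ->
  opbound (X1 *m S1 *m Y1^T - X2 *m S2 *m Y2^T) eps ->
  opbound (Y1 *m invmx S1 *m X1^T - Y2 *m invmx S2 *m X2^T)
    (golden_ratio * (a * b * eps)).
Proof.
move=> hX1 hX2 hY1 hY2 uS1 uS2 a0 b0 e0 bS1 bS2 bE.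
set E := X1 *m S1 *m Y1^T - _ in bE.
have bX : opbound (X2^T *m coproj X1) (a * eps).
  rewrite -coprojT -trmx_mul.
  apply: opboundT; first exact: mulr_ge0.
  apply: coproj_swap => //; first exact: mulr_ge0.
  exact: (sin_theta (Y1 := Y1) (S1 := S1) (Y2 := Y2) (S2 := S2)).
(* the row spaces of A and B are the ranges of A^T and B^T *)
have bY : opbound (coproj Y2 *m Y1) (b * eps).
  apply: coproj_swap => //; first exact: mulr_ge0.
  apply: (sin_theta (Y1 := X2) (S1 := S2^T) (Y2 := X1) (S2 := S1^T)) => //.
  - by rewrite unitmx_tr.
  - by rewrite -trmx_inv; apply: opboundT.
  rewrite -opprB; apply: opboundN.
  have -> : Y1 *m S1^T *m X1^T - Y2 *m S2^T *m X2^T = E^T.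
    by rewrite /E linearB /= !trmx_mul !trmxK !mulmxA.
  exact: opboundT.
set A' := Y1 *m invmx S1 *m X1^T; set B' := Y2 *m invmx S2 *m X2^T.
have dec : A' - B' = coproj Y2 *m Y1 *m (invmx S1 *m X1^T)
     - Y2 *m (invmx S2 *m (X2^T *m (E *m Y1 *m invmx S1 *m X1^T + coproj X1))).
  have -> : E *m Y1 *m invmx S1 *m X1^T =
            X1 *m X1^T - X2 *m S2 *m Y2^T *m A'.
    rewrite /E !mulmxBl; congr (_ - _).
      by rewrite -!mulmxA (mulmxA Y1^T) hY1 mul1mx (mulmxA S1) mulmxV // mul1mx.
    by rewrite /A' !mulmxA.
  have -> : X1 *m X1^T - X2 *m S2 *m Y2^T *m A' + coproj X1 =
      1%:M - X2 *m S2 *m Y2^T *m A'.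
    by rewrite addrAC /coproj [X in X - _]addrC subrK.
  have -> : Y2 *m (invmx S2 *m (X2^T *m (1%:M - X2 *m S2 *m Y2^T *m A'))) =
      B' - Y2 *m Y2^T *m A'.
    rewrite !mulmxBr mulmx1 -!mulmxA (mulmxA X2^T X2) hX2 mul1mx.
    by rewrite (mulmxA (invmx S2) S2) mulVmx // mul1mx /B' !mulmxA.
  have -> : coproj Y2 *m Y1 *m (invmx S1 *m X1^T) = A' - Y2 *m Y2^T *m A'.
    by rewrite /A' /coproj !mulmxBl mul1mx !mulmxA.
  by rewrite opprB addrA subrK.
move=> x; rewrite dec mulmxBl -mulNmx.
apply: enorm_le.
  exact: mulr_ge0 (ltW golden_ratio_gt0) (mulr_ge0 (mulr_ge0 a0 b0) e0).
rewrite pythagoras; last first.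
  rewrite mulNmx -!mulmxA dot_adj coprojT -mulmxN (mulmxA (coproj Y2) Y2).
  by rewrite coproj_annihil // mul0mx /dot mulmx0 mxE.
set z1 := X1^T *m x; set z2 := coproj X1 *m x.
set c := a * b * eps.
have c0 : 0 <= c by rewrite !mulr_ge0.
have n1 : enorm (coproj Y2 *m Y1 *m (invmx S1 *m X1^T) *m x) <= c * enorm z1.
  have -> : c = b * eps * a by rewrite /c; ring.
  by have := opboundM (mulr_ge0 b0 e0) bY bS1 z1; rewrite -!mulmxA.
have n2 : enorm (- (Y2 *m (invmx S2 *m (X2^T *m
    (E *m Y1 *m invmx S1 *m X1^T + coproj X1)))) *m x)
    <= c * enorm z1 + c * enorm z2.
  rewrite mulNmx enormN -!mulmxA enorm_isom // mulmxDl -!mulmxA -/z1.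
  (* projecting twice, X2^T (1 - P) can be applied to z2 = (1 - P) x *)
  have -> : coproj X1 *m x = coproj X1 *m z2 by rewrite mulmxA coproj_idem.
  rewrite mulmxDr mulmxDr.
  apply: le_trans (enormD _ _) _; apply: lerD.
    have -> : c = b * (1 * (eps * (1 * a))) by rewrite /c; ring.
    have bX2 : opbound X2^T 1 by apply: opboundT => //; apply: opbound_isom.
    have := opboundM b0 bS2 (opboundM ler01 bX2 (opboundM e0 bE
      (opboundM ler01 (opbound_isom hY1) bS1))) z1.
    by rewrite -!mulmxA.
  have -> : c = b * (a * eps) by rewrite /c; ring.
  by have := opboundM b0 bS2 bX z2; rewrite -!mulmxA.
rewrite -!enorm_sqr.
have ge0 := @enorm_ge0 R.
apply: (@le_trans _ _ ((c * enorm z1) ^+ 2 + (c * enorm z1 + c * enorm z2) ^+ 2)).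
  by apply: lerD; rewrite ler_pXn2r ?nnegrE ?addr_ge0 ?mulr_ge0.
have -> : (c * enorm z1) ^+ 2 + (c * enorm z1 + c * enorm z2) ^+ 2
  = c ^+ 2 * ((enorm z1 + enorm z2) ^+ 2 + enorm z1 ^+ 2) by ring.
clearbody c.
rewrite exprMn [X in _ <= X * _]mulrC -[leRHS]mulrA ler_wpM2l ?sqr_ge0 //.
rewrite [enorm x ^+ 2]enorm_sqr -(proj_split x hX1) -!enorm_sqr; exact: golden_ratio_form.
Qed.
End Projections.

(** * Partitioned matrices *)

Section Partitions.
Context {R : realType}.

Lemma cols_l_isom N k m (e : (k + m)%N = N) (Q : 'M[R]_N) :
  orthogonal_mx Q -> (cols_l e Q)^T *m cols_l e Q = 1%:M.
Proof.
case: N / e Q => Q; rewrite /cols_l castmx_id /orthogonal_mx.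
rewrite -{1 2}[Q]hsubmxK tr_row_mx mul_col_row scalar_mx_block.
by case/eq_block_mx.
Qed.

Lemma cols_r_isom N k m (e : (k + m)%N = N) (Q : 'M[R]_N) :
  orthogonal_mx Q -> (cols_r e Q)^T *m cols_r e Q = 1%:M.
Proof.
case: N / e Q => Q; rewrite /cols_r castmx_id /orthogonal_mx.
rewrite -{1 2}[Q]hsubmxK tr_row_mx mul_col_row scalar_mx_block.
by case/eq_block_mx.
Qed.

Lemma coproj_cols_l N k m (e : (k + m)%N = N) (Q : 'M[R]_N) :
  orthogonal_mx Q -> coproj (cols_l e Q) = cols_r e Q *m (cols_r e Q)^T.
Proof.
case: N / e Q => Q; rewrite /coproj /cols_r /cols_l castmx_id.
move=> /mulmx1C; rewrite -{1 2}[Q]hsubmxK tr_row_mx mul_row_col => <-.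
by rewrite addrC addKr.
Qed.

Lemma cols_l_mulmx N k m (e : (k + m)%N = N) (A X : 'M[R]_N) :
  cols_l e (A *m X) = A *m cols_l e X.
Proof. by case: N / e A X => A X; rewrite /cols_l !castmx_id mulmx_lsub. Qed.

Lemma cols_l_mul_block N k m (e : (k + m)%N = N) (X M : 'M[R]_N) :
  cols_l e (X *m M) = cols_l e X *m block11 e M + cols_r e X *m block21 e M.
Proof.
case: N / e X M => X M.
rewrite /cols_l /cols_r /block11 /block21 !castmx_id.
by rewrite -{1}[X]hsubmxK -{1}[M]submxK mul_row_block row_mxKl.
Qed.

Lemma block11_pad N k m (e : (k + m)%N = N) (M : 'M[R]_N) (Q Q' : 'M[R]_k) :
  block11 e ((pad1 e Q)^T *m M *m pad1 e Q') = Q^T *m block11 e M *m Q'.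
Proof.
case: N / e M => M; rewrite /block11 /pad1 !castmx_id.
rewrite -{1}[M]submxK tr_block_mx !mulmx_block block_mxKul.
by rewrite !trmx0 !mul0mx !mulmx0 !addr0.
Qed.

Lemma block21_pad N k m (e : (k + m)%N = N) (M : 'M[R]_N) (Q Q' : 'M[R]_k) :
  block21 e ((pad1 e Q)^T *m M *m pad1 e Q') = block21 e M *m Q'.
Proof.
case: N / e M => M; rewrite /block21 /pad1 !castmx_id.
rewrite -{1}[M]submxK tr_block_mx !mulmx_block block_mxKdl.
by rewrite !trmx0 !mul0mx !mulmx0 !addr0 add0r trmx1 mul1mx.
Qed.

Lemma pad_orthogonal N k m (e : (k + m)%N = N) (Q : 'M[R]_k) :
  orthogonal_mx Q -> orthogonal_mx (pad1 e Q).
Proof.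
rewrite /orthogonal_mx => hQ; case: N / e; rewrite /pad1 castmx_id.
rewrite tr_block_mx mulmx_block !trmx0 !mul0mx !mulmx0 !addr0 add0r.
by rewrite hQ trmx1 mulmx1 -scalar_mx_block.
Qed.

Lemma block11D N k m (e : (k + m)%N = N) (M M' : 'M[R]_N) :
  block11 e (M + M') = block11 e M + block11 e M'.
Proof.
case: N / e M M' => M M'; rewrite /block11 !castmx_id.
by apply/matrixP => i j; rewrite !mxE.
Qed.

Lemma block21D N k m (e : (k + m)%N = N) (M M' : 'M[R]_N) :
  block21 e (M + M') = block21 e M + block21 e M'.
Proof.
case: N / e M M' => M M'; rewrite /block21 !castmx_id.
by apply/matrixP => i j; rewrite !mxE.
Qed.

Lemma block11_diag N k m (e : (k + m)%N = N) (s : nat -> R) :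
  block11 e (diag N s) = diag k s.
Proof.
case: N / e; rewrite /block11 castmx_id; apply/matrixP => i j.
by rewrite !mxE /= (inj_eq (@lshift_inj _ _)).
Qed.

Lemma block21_diag N k m (e : (k + m)%N = N) (s : nat -> R) :
  block21 e (diag N s) = 0.
Proof.
case: N / e; rewrite /block21 castmx_id; apply/matrixP => i j.
by rewrite !mxE eq_rlshift.
Qed.

End Partitions.

(** * Orthogonal matrices and Kronecker sums *)

Section Kronecker.
Context {R : realType}.

Lemma orthogonal_mulmx N (P Q : 'M[R]_N) :
  orthogonal_mx P -> orthogonal_mx Q -> orthogonal_mx (P *m Q).
Proof.
by move=> hP hQ; rewrite /orthogonal_mx trmx_mul mulmxA -(mulmxA Q^T) hP mulmx1.
Qed.

Lemma orthogonal_perm N (P : 'M[R]_N) : is_perm_mx P -> orthogonal_mx P.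
Proof.
case/is_perm_mxP => p ->; rewrite /orthogonal_mx tr_perm_mx -perm_mxM.
by rewrite mulVg perm_mx1.
Qed.

Lemma orthogonal_tens n (P Q : 'M[R]_n) :
  orthogonal_mx P -> orthogonal_mx Q -> orthogonal_mx (P *t Q).
Proof.
move=> hP hQ; rewrite /orthogonal_mx trmx_tens tensmx_mul hP hQ.
apply/matrixP => i j; case: (mxtens_indexP i) => i1 i2.
case: (mxtens_indexP j) => j1 j2; rewrite tensmxE !mxE.
by rewrite (can_eq (@mxtens_indexK _ _)) xpair_eqE -natrM mulnb.
Qed.

(** The rearrangement is linear, injective and turns A *t B into
    vec A (vec B)^T, so a decomposition of the rearranged matrix into
    rank one terms is a Kronecker sum decomposition of K. *)
Lemma kron_sum_rearrange n r (K : 'M[R]_(n * n)) s u v (A B : nat -> 'M[R]_n) :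
  is_compact_svd (rearrange K) r s u v ->
  (forall i : nat, (i < r)%N -> vec (A i) = Num.sqrt (s i) *: u i) ->
  (forall i : nat, (i < r)%N -> vec (B i) = Num.sqrt (s i) *: v i) ->
  K = kron_sum 0 r A B.
Proof.
move=> [_ _ _ s0 hK] hA hB.
have inj : injective (@rearrange R n).
  move=> M M' /matrixP h; apply/matrixP => i j.
  case: (mxtens_indexP i) => i1 i2; case: (mxtens_indexP j) => j1 j2.
  have := h (mxtens_index (j1, i1)) (mxtens_index (j2, i2)).
  by rewrite !mxE !mxtens_indexK.
apply: inj; rewrite hK /kron_sum.
have rD M M' : rearrange (M + M') = rearrange M + rearrange M' :> 'M[R]_(n * n).
  by apply/matrixP => i j; rewrite !mxE.
have r0 : rearrange 0 = 0 :> 'M[R]_(n * n) by apply/matrixP => i j; rewrite !mxE.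
rewrite (big_morph _ rD r0); apply: eq_big_nat => i /andP[_ ir].
rewrite rearrange_tens hA // hB // linearZ /= -scalemxAl -scalemxAr scalerA.
by rewrite -expr2 sqr_sqrtr // ltW ?s0.
Qed.

End Kronecker.

(** * Singular value decompositions *)

Section SingularValues.
Context {R : realType}.

Lemma svd_cols_l N k m (e : (k + m)%N = N) (K U V : 'M[R]_N) s :
  is_svd K U s V -> K *m cols_l e V = cols_l e U *m diag k s.
Proof.
move=> [_ hV _ _ ->]; rewrite -cols_l_mulmx -mulmxA hV mulmx1.
by rewrite cols_l_mul_block block11_diag block21_diag mulmx0 addr0.
Qed.

Lemma svd_opbound N (K U V : 'M[R]_N) s :
  is_svd K U s V -> (0 < N)%N -> opbound K (s 0%N).
Proof.
move=> [hU hV mono nn ->] N0; have s00 := nn _ N0.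
have bV : opbound V^T 1 by apply: opboundT => //; apply: opbound_isom.
have bS : opbound (diag N s) (s 0%N).
  by apply: opbound_diag => // i iN; rewrite ger0_norm ?nn // mono.
have := opboundM (mulr_ge0 ler01 s00) (opboundM ler01 (opbound_isom hU) bS) bV.
by rewrite mul1r mulr1.
Qed.
Lemma diag_unit k (s : nat -> R) c : 0 < c ->
  (forall i : nat, (i < k)%N -> c <= s i) ->
  diag k s \in unitmx /\ opbound (invmx (diag k s)) c^-1.
Proof.
move=> c0 hs.
have uS : diag k s \in unitmx.
  rewrite unitmxE det_diag unitfE; apply/prodf_neq0 => i _.
  by rewrite mxE gt_eqF // (lt_le_trans c0) ?hs.
have DD : diag k (fun i => (s i)^-1) *m diag k s = 1%:M.
  apply/matrixP => i j; rewrite /diag mul_diag_mx !mxE.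
  have [->|_] := eqVneq i j; last by rewrite mulr0.
  by rewrite mulVf // gt_eqF // (lt_le_trans c0) ?hs.
split=> //; have -> : invmx (diag k s) = diag k (fun i => (s i)^-1).
  by rewrite -[RHS]mulmx1 -(mulmxV uS) mulmxA DD mul1mx.
apply: opbound_diag => [|i ik]; first by rewrite invr_ge0 ltW.
have si0 := lt_le_trans c0 (hs i ik).
by rewrite normfV gtr0_norm // lef_pV2 ?posrE // hs.
Qed.

End SingularValues.

(** * Truncated singular value decompositions *)

(** If K = X M Y^T and only the leading block of M is diagonalized, the leading
    columns of the updated bases fail to be singular vectors of K exactly by
    the block of M below the leading one. *)
Lemma partial_svd_residual (R : realType) N k m (e : (k + m)%N = N)
    (K X Y M : 'M[R]_N) (Ut Vt : 'M[R]_k) (sh : nat -> R) :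
  orthogonal_mx Y -> K = X *m M *m Y^T -> is_svd (block11 e M) Ut sh Vt ->
  K *m cols_l e (Y *m pad1 e Vt) =
    cols_l e (X *m pad1 e Ut) *m diag k sh
    + cols_r e (X *m pad1 e Ut) *m (block21 e M *m Vt).
Proof.
move=> hY -> [hU hV _ _ hM].
have hpU : pad1 e Ut *m (pad1 e Ut)^T = 1%:M by apply/mulmx1C/pad_orthogonal.
have -> : diag k sh = block11 e ((pad1 e Ut)^T *m M *m pad1 e Vt).
  rewrite block11_pad hM !mulmxA hU mul1mx.
  by rewrite -mulmxA hV mulmx1.
rewrite -(block21_pad e M Ut Vt) -cols_l_mul_block -cols_l_mulmx.
congr cols_l; rewrite -!mulmxA (mulmxA Y^T) hY mul1mx.
by rewrite (mulmxA (pad1 e Ut)) hpU mul1mx.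
Qed.

(** Since X1 S1 = K Y1 and X2 S2 = K Y2 - Z G, the difference equals
    K (Y1 Y1^T - Y2 Y2^T) + Z G Y2^T. *)
Lemma tsvd_diff_bound (R : realType) N k m (K : 'M[R]_N)
    (X1 X2 Y1 Y2 : 'M[R]_(N, k)) (S1 S2 : 'M[R]_k) (Z : 'M[R]_(N, m))
    (G : 'M[R]_(m, k)) c t g :
  Y1^T *m Y1 = 1%:M -> Y2^T *m Y2 = 1%:M -> Z^T *m Z = 1%:M ->
  K *m Y1 = X1 *m S1 -> K *m Y2 = X2 *m S2 + Z *m G ->
  0 <= c -> 0 <= t -> 0 <= g ->
  opbound K c -> opbound (Y1^T *m coproj Y2) t -> opbound G g ->
  opbound (X1 *m S1 *m Y1^T - X2 *m S2 *m Y2^T) (c * t + g).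
Proof.
move=> hY1 hY2 hZ hK1 hK2 c0 t0 g0 bK bt bG.
have -> : X1 *m S1 *m Y1^T - X2 *m S2 *m Y2^T =
    K *m (Y1 *m Y1^T - Y2 *m Y2^T) + Z *m G *m Y2^T.
  rewrite mulmxBr !mulmxA hK1 hK2 mulmxDl.
  by rewrite opprD addrA subrK.
apply: opboundD; first by apply: opboundM => //; apply: proj_diff_bound.
rewrite -[g]mulr1 -[g]mul1r; apply: opboundM; first by rewrite mul1r.
  by apply: opboundM => //; apply: opbound_isom.
by apply: opboundT => //; apply: opbound_isom.
Qed.

(** The Pythagorean theorem for the splitting of d along the range of X. *)
Lemma residual_ratio (R : realType) N k (X : 'M[R]_(N, k)) (d : 'cV[R]_N) :
  X^T *m X = 1%:M -> d != 0 ->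
  Num.sqrt (1 - enorm (coproj X *m d) ^+ 2 / enorm d ^+ 2) =
    enorm (X^T *m d) / enorm d.
Proof.
move=> hX d0; have dd : dot d d != 0 by rewrite -enorm_sqr sqrf_eq0 enorm_eq0.
rewrite !enorm_sqr.
have -> : 1 - dot (coproj X *m d) (coproj X *m d) / dot d d =
    (enorm (X^T *m d) / enorm d) ^+ 2.
  rewrite exprMn exprVn !enorm_sqr -[1](divff dd) -mulrBl.
  by rewrite -{1}(proj_split d hX) addrK.
by rewrite sqrtr_sqr ger0_norm // divr_ge0 ?enorm_ge0.
Qed.

Theorem theorem3p3 (R : realType) (n k : nat) (hk0 : (1 <= k)%N)
    (hkN : (k < n * n)%N) (K : 'M[R]_(n * n))
    (* true SVD of K *)
    (U V : 'M[R]_(n * n)) (sigma : nat -> R)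
    (hK : is_svd K U sigma V)
    (* Kronecker sum decomposition of K, of length the Kronecker rank r *)
    (r : nat) (hr : is_kronecker_rank K r)
    (s : nat -> R) (u v : nat -> 'cV[R]_(n * n))
    (hKt : is_compact_svd (rearrange K) r s u v)
    (A B : nat -> 'M[R]_n)
    (hA : forall i : nat, (i < r)%N -> vec (A i) = Num.sqrt (s i) *: u i)
    (hB : forall i : nat, (i < r)%N -> vec (B i) = Num.sqrt (s i) *: v i)
    (* SVDs of the leading Kronecker factors *)
    (UA VA UB VB : 'M[R]_n) (sA sB : nat -> R)
    (hA1 : is_svd (A 0%N) UA sA VA) (hB1 : is_svd (B 0%N) UB sB VB)
    (* permutation sorting the Kronecker product of the singular values *)
    (P : 'M[R]_(n * n)) (hP : is_perm_mx P)
    (sigma1 : nat -> R) (hsigma1 : nonincreasing_upto (n * n) sigma1)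
    (hPS : P^T *m (diag n sA *t diag n sB) *m P = diag (n * n) sigma1)
    (* SVD of the leading k x k block *)
    (Ut Vt : 'M[R]_k) (sigmah : nat -> R) :
  let e : (k + (n * n - k))%N = (n * n)%N := subnKC (ltnW hkN) in
  let U1 := UA *t UB in
  let V1 := VA *t VB in
  let W := U1^T *m kron_sum 1 r A B *m V1 in
  let W11 := block11 e (P^T *m W *m P) in
  let W21 := block21 e (P^T *m W *m P) in
  is_svd (diag k sigma1 + W11) Ut sigmah Vt ->
  let Uh := U1 *m P *m pad1 e Ut in
  let Vh := V1 *m P *m pad1 e Vt in
  let W21h := W21 *m Vt in
  let KTSVD := cols_l e U *m diag k sigma *m (cols_l e V)^T in
  let KhTSVD := cols_l e Uh *m diag k sigmah *m (cols_l e Vh)^T in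
  0 < sigma k.-1 ->
  0 < sigmah k.-1 ->
  forall d : 'cV[R]_(n * n),
  let x := mpinv KTSVD *m d in
  let xh := mpinv KhTSVD *m d in
  let res := d - K *m x in
  x != 0 ->
  enorm (x - xh) / enorm x <=
    golden_ratio * sigma 0%N /
      (sigma k.-1 * sigmah k.-1
         * Num.sqrt (1 - enorm res ^+ 2 / enorm d ^+ 2))
    * (sigma 0%N * specnorm ((cols_l e V)^T *m cols_r e Vh) + specnorm W21h).
Proof.
move=> e U1 V1 W W11 W21 hW11 Uh Vh W21h KTSVD KhTSVD sk0 shk0 d x xh res x0.
have N0 : (0 < n * n)%N := leq_ltn_trans (leq0n k) hkN.
case: (hK) => hU hV mono nn _.
case: (hW11) => hUt hVt monoh nnh _.
case: hA1 => hUA hVA _ _ eA1; case: hB1 => hUB hVB _ _ eB1.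
have km1 i : (i < k)%N -> (i <= k.-1)%N by move=> ik; rewrite -ltnS prednK.
have sge i : (i < k)%N -> sigma k.-1 <= sigma i.
  move=> ik; apply: mono; rewrite km1 //=.
  exact: leq_ltn_trans (leq_pred k) hkN.
have shge i : (i < k)%N -> sigmah k.-1 <= sigmah i.
  by move=> ik; apply: monoh; rewrite km1 //= prednK.
have s00 : 0 < sigma 0%N by apply: lt_le_trans sk0 (sge _ hk0).
have bK := svd_opbound hK N0.
have hKV := svd_cols_l e hK.
have hUk := cols_l_isom e hU; have hVk := cols_l_isom e hV.
set Uk := cols_l e U in KTSVD x res x0 hKV hUk *.
set Vk := cols_l e V in KTSVD x res x0 hKV hVk *.
have [uS bS] := diag_unit sk0 sge.
have [uSh bSh] := diag_unit shk0 shge.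
have eK := kron_sum_rearrange hKt hA hB.
(* r = 0 would give K = 0, against sigma_1 > 0 *)
have r0 : (0 < r)%N.
  rewrite lt0n; apply/eqP => r0; move: eK; rewrite r0 /kron_sum big_geq // => K0.
  have S0 : diag k sigma = 0.
    by rewrite -[LHS]mul1mx -hUk -mulmxA -hKV K0 mul0mx mulmx0.
  move/matrixP: S0 => /(_ (Ordinal hk0) (Ordinal hk0)).
  by rewrite !mxE eqxx mulr1n /= => s0; move: s00; rewrite s0 ltxx.
have hU1 : orthogonal_mx U1 by apply: orthogonal_tens.
have hV1 : orthogonal_mx V1 by apply: orthogonal_tens.
have hPo := orthogonal_perm hP.
have hPo' := mulmx1C hPo.
have hU1P := orthogonal_mulmx hU1 hPo; have hV1P := orthogonal_mulmx hV1 hPo.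
have hUh : orthogonal_mx Uh by apply: orthogonal_mulmx => //; apply: pad_orthogonal.
have hVh : orthogonal_mx Vh by apply: orthogonal_mulmx => //; apply: pad_orthogonal.
(* K = U1 (Sigma_1 + W) V1^T, conjugated by the sorting permutation *)
have eKM : K = U1 *m P *m (diag (n * n) sigma1 + P^T *m W *m P) *m (V1 *m P)^T.
  have -> : diag (n * n) sigma1 + P^T *m W *m P =
      P^T *m (diag n sA *t diag n sB + W) *m P.
    by rewrite -hPS mulmxDr mulmxDl.
  rewrite trmx_mul -!mulmxA (mulmxA P P^T) hPo' mul1mx (mulmxA P P^T) hPo' mul1mx.
  rewrite mulmxDl mulmxDr /W -!mulmxA (mulmx1C hV1) mulmx1.
  rewrite [X in _ + X]mulmxA (mulmx1C hU1) mul1mx.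
  rewrite /U1 /V1 trmx_tens !tensmx_mul !mulmxA -eA1 -eB1.
  by rewrite {1}eK /kron_sum big_ltn.
have hKVh : K *m cols_l e Vh =
    cols_l e Uh *m diag k sigmah + cols_r e Uh *m W21h.
  have := partial_svd_residual hV1P eKM (e := e) (Ut := Ut) (Vt := Vt) (sh := sigmah).
  by rewrite block11D block21D block11_diag block21_diag add0r => ->.
have hUhk := cols_l_isom e hUh; have hVhk := cols_l_isom e hVh.
pose t := specnorm (Vk^T *m cols_r e Vh).
have bt : opbound (Vk^T *m coproj (cols_l e Vh)) t.
  rewrite coproj_cols_l // mulmxA -[t]mulr1.
  apply: opboundM; [exact: specnorm_ge0 | exact: opbound_specnorm |].
  by apply: opboundT => //; apply: opbound_isom; apply: cols_r_isom.
have t0 : 0 <= t := specnorm_ge0 _.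
have g0 := specnorm_ge0 W21h.
have bE := tsvd_diff_bound hVk hVhk (cols_r_isom e hUh) hKV hKVh (ltW s00) t0 g0
  bK bt (@opbound_specnorm _ _ _ _).
rewrite -/t; set eps := sigma 0%N * t + specnorm W21h in bE *.
have eps0 : 0 <= eps by rewrite addr_ge0 // mulr_ge0 // ltW.
have ex : x = Vk *m invmx (diag k sigma) *m Uk^T *m d.
  by rewrite /x mpinv_tsvd // => i ik; apply: lt_le_trans sk0 (sge _ ik).
have exh : xh = cols_l e Vh *m invmx (diag k sigmah) *m (cols_l e Uh)^T *m d.
  by rewrite /xh mpinv_tsvd // => i ik; apply: lt_le_trans shk0 (shge _ ik).
have hdiff : enorm (x - xh) <=
    golden_ratio * ((sigma k.-1)^-1 * (sigmah k.-1)^-1 * eps) * enorm d.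
  rewrite ex exh -mulmxBl.
  by apply: wedin_pinv => //; rewrite invr_ge0 ltW.
have hy : Uk^T *m d = diag k sigma *m (Vk^T *m x).
  rewrite ex -!mulmxA (mulmxA Vk^T) hVk mul1mx mulmxA.
  by rewrite mulmxV // mul1mx.
have hres : res = coproj Uk *m d.
  rewrite /res ex !mulmxA hKV -(mulmxA Uk) mulmxV // mulmx1.
  by rewrite mulmxBl mul1mx.
have d0 : d != 0.
  by apply: contra_neq x0 => d0; rewrite ex d0 mulmx0.
have y0 : Uk^T *m d != 0.
  by apply: contra_neq x0 => y0; rewrite ex -mulmxA y0 mulmx0.
rewrite hres residual_ratio //.
have hny : enorm (Uk^T *m d) <= sigma 0%N * enorm x.
  have bD : opbound (diag k sigma) (sigma 0%N).
    apply: opbound_diag => [|i ik]; first exact: ltW.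
    rewrite ger0_norm; last by apply: le_trans (ltW sk0) (sge _ ik).
    by apply: mono; rewrite (ltn_trans ik hkN).
  have bVk : opbound Vk^T 1 by apply: opboundT => //; apply: opbound_isom.
  rewrite hy mulmxA.
  by have := opboundM (ltW s00) bD bVk x; rewrite mulr1.
have nd0 : 0 < enorm d by rewrite enorm_gt0.
have ny0 : 0 < enorm (Uk^T *m d) by rewrite enorm_gt0.
have nx0 : 0 < enorm x by rewrite enorm_gt0.
rewrite ler_pdivrMr //; apply: le_trans hdiff _.
set phi := golden_ratio; have phi0 : 0 < phi := golden_ratio_gt0.
set ny := enorm (Uk^T *m d) in hny ny0 *; set nd := enorm d in nd0 *.
have -> : phi * sigma 0%N / (sigma k.-1 * sigmah k.-1 * (ny / nd)) * eps * enorm x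
    = phi * ((sigma k.-1)^-1 * (sigmah k.-1)^-1 * eps) * nd
      * (sigma 0%N * enorm x / ny).
  by field; rewrite !gt_eqF.
rewrite ler_peMr //; last by rewrite ler_pdivlMr // mul1r.
have sk' : 0 <= (sigma k.-1)^-1 by rewrite invr_ge0 ltW.
have shk' : 0 <= (sigmah k.-1)^-1 by rewrite invr_ge0 ltW.
exact: mulr_ge0 (mulr_ge0 (ltW phi0) (mulr_ge0 (mulr_ge0 sk' shk') eps0)) (ltW nd0).
Qed.
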